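(* Let $B$ be a Banach space. For every $0\le\alpha<1$ and for every bounded $\alpha$-paraconvex subset $P\subset B$, the set $URetr(P)$ of all uniform continuous retractions of $B$ onto $P$ is an $\frac{\alpha}{1-\alpha}$-paraconvex subset of $C_b(B,B)$.
   Context: For a number $\alpha\ge 0$, a nonempty closed subset $P$ of a normed space $Y$ is called $\alpha$-paraconvex if for every $r>0$, every open ball $D_r\subset Y$ of radius $r$ and every $q\in \mathrm{conv}(P\cap D_r)$ one has $\mathrm{dist}(q,P)\le \alpha\cdot r$. $C_b(B,B)$ is the Banach space of all continuous bounded mappings of $B$ into itself, with the sup norm. A continuous retraction of $B$ onto $A\subset B$ is a continuous map $R:B\to B$ with $R(B)\subset A$ and $R(a)=a$ for all $a\in A$. It is called uniform (with respect to $A$) if for every $\varepsilon>0$ there exists $\delta>0$ such that for all $x\in B$: $\mathrm{dist}(x,A)<\delta$ implies $\mathrm{dist}(x,R(x))<\varepsilon$. (This is not uniform continuity of $R$.) $URetr(A)$ denotes the set of all continuous retractions of $B$ onto $A$ which are uniform with respect to $A$; for bounded $A$ it is a subset of $C_b(B,B)$. *)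

(* Defs.v *)
From HB Require Import structures.
From mathcomp Require Import all_boot all_order all_algebra.
From mathcomp Require Import all_classical all_reals all_analysis.
From mathcomp Require Import ring.
Import Order.TTheory GRing.Theory Num.Theory.
Import numFieldNormedType.Exports.

Set Implicit Arguments.
Unset Strict Implicit.
Unset Printing Implicit Defensive.

Local Open Scope classical_set_scope.
Local Open Scope ring_scope.

Section bounded_continuous.
Context (R : realType) (X : topologicalType) (Y : normedModType R).
Implicit Types f : X -> Y.

Definition Cb_pred : {pred X -> Y} :=
  [pred f | `[< continuous f /\ bounded_fun f >]].

Lemma bounded_funE f : bounded_fun f <-> exists M : R, forall x, `|f x| <= M.
Proof.
split=> [bf|[M fM]].
  by have [M fM] := @filter_ex _ (+oo : set_system R) _ _ bf; exists M => x; exact: fM.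
exists M; split=> [|N MN x _ /=]; first exact: num_real.
exact: le_trans (fM x) (ltW MN).
Qed.

Lemma Cb_submod_closed : submod_closed Cb_pred.
Proof.
split=> [|a f g /asboolP[cf bf] /asboolP[cg bg]]; apply/asboolP; split.
- exact: cst_continuous.
- by apply/bounded_funE; exists 0 => x; rewrite normr0.
- move=> x; apply: (@continuousD _ _ _ (a *: f) g x); last exact: cg.
  exact: continuousZl_tmp (cf x).
- move/bounded_funE: bf => [M fM]; move/bounded_funE: bg => [N gN].
  apply/bounded_funE; exists (`|a| * M + N) => x.
  apply: (le_trans (ler_normD _ _)); apply: lerD; last exact: gN.
  by rewrite normrZ ler_wpM2l//; exact: fM.
Qed.

HB.instance Definition _ :=
  GRing.isSubmodClosed.Build _ _ Cb_pred Cb_submod_closed.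

Record Cb := MkCb { Cb_fun :> X -> Y ; Cb_funP : Cb_fun \in Cb_pred }.

HB.instance Definition _ := [isSub for Cb_fun].
HB.instance Definition _ := [Choice of Cb by <:].
HB.instance Definition _ := [SubChoice_isSubLmodule of Cb by <:].


Definition sup_norm (f : Cb) : R := sup [set `|f x| | x in [set: X]].

Lemma Cb_continuous (f : Cb) : continuous f.
Proof. by have /asboolP[] := Cb_funP f. Qed.

Lemma Cb_bounded (f : Cb) : bounded_fun f.
Proof. by have /asboolP[] := Cb_funP f. Qed.

Lemma sup_norm_ub (f : Cb) (x : X) : `|f x| <= sup_norm f.
Proof.
apply: ub_le_sup; last by exists x.
have /bounded_funE[M fM] := Cb_bounded f.
by exists M => _ [y _ <-]; exact: fM.
Qed.

Lemma sup_norm_empty (f : Cb) : ~ ([set: X] !=set0) -> sup_norm f = 0.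
Proof.
move=> X0; rewrite /sup_norm; have -> : [set: X] = set0.
  by apply/seteqP; split=> // x _; case: X0; exists x.
by rewrite image_set0 sup0.
Qed.

Lemma sup_norm_le (f : Cb) (M : R) :
  0 <= M -> (forall x, `|f x| <= M) -> sup_norm f <= M.
Proof.
move=> M0 fM; have [[x _]|X0] := pselect ([set: X] !=set0).
  apply: sup_le_ub => [|_ [y _ <-]]; last exact: fM.
  by exists `|f x|, x.
by rewrite (sup_norm_empty _ X0).
Qed.

Lemma sup_norm_ge0 (f : Cb) : 0 <= sup_norm f.
Proof.
have [[x _]|X0] := pselect ([set: X] !=set0).
  exact: le_trans (sup_norm_ub f x).
by rewrite (sup_norm_empty _ X0).
Qed.

Lemma sup_normD (f g : Cb) : sup_norm (f + g) <= sup_norm f + sup_norm g.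
Proof.
apply: sup_norm_le => [|x]; first by rewrite addr_ge0// sup_norm_ge0.
by apply: (le_trans (ler_normD _ _)); rewrite lerD// sup_norm_ub.
Qed.

Lemma sup_normZ (a : R) (f : Cb) : sup_norm (a *: f) = `|a| * sup_norm f.
Proof.
have le (b : R) (g : Cb) : sup_norm (b *: g) <= `|b| * sup_norm g.
  apply: sup_norm_le => [|x]; first by rewrite mulr_ge0// sup_norm_ge0.
  by rewrite normrZ ler_wpM2l// sup_norm_ub.
apply/eqP; rewrite eq_le le/=.
have [->|a0] := eqVneq a 0; first by rewrite normr0 mul0r sup_norm_ge0.
rewrite -ler_pdivlMl ?normr_gt0// -normfV.
by rewrite -[X in sup_norm X](scalerK a0) le.
Qed.

Lemma sup_norm_eq0 (f : Cb) : sup_norm f = 0 -> f = 0.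
Proof.
move=> f0; apply/val_inj/funext => x; apply/eqP.
by rewrite -normr_le0 -f0 sup_norm_ub.
Qed.

(* The topology of Cb is the one induced by the sup norm; it is unrelated to the
   function-space topologies of X -> Y. *)
HB.instance Definition _ :=
  Lmodule_isNormed.Build R Cb sup_normD sup_normZ sup_norm_eq0.

Lemma Cb_normE (f : Cb) : `|f| = sup [set `|f x| | x in [set: X]].
Proof. by []. Qed.

End bounded_continuous.

Section bounded_continuous_complete.
Context (R : realType) (X : topologicalType) (Y : completeNormedModType R).

Lemma Cb_cauchy_cvg (F : set_system (Cb X Y)) :
  ProperFilter F -> cauchy F -> cvg F.
Proof.
move=> FF cF.
have cFe (e : R) : 0 < e -> exists f0, \forall f \near F, `|f0 - f| < e.
  move=> e0; have /cauchyP/(_ e e0)[f0 f0F] := cF.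
  by exists f0; move: f0F; rewrite -ball_normE.
have cFx x : cauchy ((fun f : Cb X Y => f x) @ F).
  apply: cauchy_exP => e /cFe[f0 f0F]; exists (f0 x).
  apply: filterS f0F => f; rewrite -ball_normE /=; apply: le_lt_trans.
  exact: (sup_norm_ub (f0 - f) x).
pose g x := lim ((fun f : Cb X Y => f x) @ F).
have gx x : (fun f : Cb X Y => f x) @ F --> g x.
  exact: (@cauchy_cvg _ _ _ (cFx x)).
have unif (e : R) : 0 < e -> \forall f \near F, forall x, `|(f : Cb X Y) x - g x| <= e.
  move=> e0; have e20 : 0 < e / 2 by rewrite divr_gt0.
  have [f0 f0F] := cFe _ e20.
  apply: filterS (f0F) => f ff0 x.
  have e2e : e / 2 + e / 2 = e by rewrite -splitr.
  apply/ler_addgt0Pr => d d0.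
  near F => h.
  have f0h : `|f0 x - h x| < e / 2.
    by apply: (le_lt_trans (sup_norm_ub (f0 - h) x)); near: h.
  have hg : `|h x - g x| < d.
    by rewrite distrC; near: h; by move: (gx x) => /cvgrPdist_lt; exact.
  rewrite -e2e; apply: (le_trans (ler_distD (h x) _ _)); apply: lerD (ltW hg).
  apply: (le_trans (ler_distD (f0 x) _ _)); apply: lerD (ltW f0h).
  rewrite distrC.
  exact: (le_trans (sup_norm_ub (f0 - f) x) (ltW ff0)).
have gC : g \in @Cb_pred R X Y.
  apply/asboolP; split=> [x|].
    apply/cvgrPdist_le => e e0.
    have e30 : 0 < e / 3 by rewrite divr_gt0.
    have [f fg] := filter_ex (unif _ e30).
    have /cvgrPdist_le/(_ _ e30) := @Cb_continuous _ _ _ f x.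
    apply: filterS => y fxy.
    have -> : e = e / 3 + e / 3 + e / 3 by field.
    apply: (le_trans (ler_distD (f y) _ _)); apply: lerD (fg y).
    apply: (le_trans (ler_distD (f x) _ _)); apply: lerD fxy.
    by rewrite distrC.
  have [f fg] := filter_ex (unif _ ltr01).
  have /bounded_funE[M fM] := Cb_bounded f.
  apply/bounded_funE; exists (M + 1) => x.
  rewrite -[g x](subKr (f x)); apply: (le_trans (ler_normB _ _)).
  exact: lerD.
apply/cvg_ex; exists (MkCb gC); apply/cvgrPdist_le => e e0.
apply: filterS (unif _ e0) => f fg.
apply: sup_norm_le => [|x]; first exact: ltW.
by rewrite distrC; exact: fg.
Unshelve. all: by end_near. Qed.

HB.instance Definition _ := Uniform_isComplete.Build (Cb X Y) Cb_cauchy_cvg.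

End bounded_continuous_complete.

Section paraconvex.
Context (R : realType) (Y : normedModType R).

Definition conv_hull (A : set Y) : set Y := smallest (@convex_set R Y) A.

(* edist_inf P q is the extended-real distance from q to P; for the metric
   induced by a norm, edist (x, y) = `|x - y|%:E. *)
Definition paraconvex (alpha : R) (P : set Y) : Prop :=
  [/\ P !=set0, closed P &
    forall (r : R) (c q : Y), 0 < r -> conv_hull (P `&` ball c r) q ->
      (edist_inf P q <= (alpha * r)%:E)%E].

End paraconvex.

Section retractions.
Context (R : realType) (B : normedModType R).

Definition continuous_retraction (A : set B) (f : B -> B) : Prop :=
  [/\ continuous f, range f `<=` A & forall a, A a -> f a = a].

Definition uniform_retraction (A : set B) (f : B -> B) : Prop :=
  forall eps : R, 0 < eps -> exists2 delta : R, 0 < delta &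
    forall x, (edist_inf A x < delta%:E)%E -> `|x - f x| < eps.

(* When A is bounded, every continuous retraction onto A is bounded, so that
   quantifying over Cb B B excludes no retraction. *)
Definition URetr (A : set B) : set (Cb B B) :=
  [set f | continuous_retraction A f /\ uniform_retraction A f].

End retractions.

(* Main.v *)
(** For [p = (z, t)] in the open set [Z] of pairs with [dist(z, P) < t], a
    partition of unity subordinate to the cover of [Z] by the sets
    [{(z, t) | `|z - y| < t}], [y] in [P], yields a continuous [Phi] with
    [Phi (z, t)] in [conv (P `&` ball z t)], hence with
    [dist (Phi (z, t), P) <= alpha t].  Iterating [z |-> Phi (z, beta^n t)] for
    [alpha < beta < 1] converges to a continuous [Psi : Z -> P] such that
    [`|Psi (z, t) - z| <= t / (1 - beta)].

    If [g] is continuous, fixes [P] pointwise and is uniform with respect to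
    [P], then [x |-> Psi (g x, rho x)] with
    [rho x = dist (g x, P) + min (eps, dist (x, P))], extended by the identity
    on [P], is a uniform retraction: the radius [rho] is positive off [P] and
    tends to [0] uniformly as [x] approaches [P].  With [g = id] this shows that
    [URetr P] is nonempty.  With [g = q] in the convex hull of the retractions
    in a ball of radius [r], one has [dist (q x, P) <= alpha r] for all [x], so
    that the retraction is within [(alpha r + eps) / (1 - beta)] of [q]; let
    [beta] tend to [alpha] and [eps] to [0]. *)

Require Import Defs.
From HB Require Import structures.
From mathcomp Require Import all_boot all_order all_algebra.
From mathcomp Require Import all_classical all_reals all_analysis.
From mathcomp Require Import wochoice ring lra.
Import Order.TTheory GRing.Theory Num.Theory.
Import numFieldNormedType.Exports.

Set Implicit Arguments.
Unset Strict Implicit.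
Unset Printing Implicit Defensive.

Local Open Scope classical_set_scope.
Local Open Scope ring_scope.

(** * Suprema of bounded real families *)

Lemma sup_range_ge (R : realType) (I : Type) (u : I -> R) (M : R) (i : I) :
  (forall j, u j <= M) -> u i <= sup (range u).
Proof. by move=> uM; apply: ub_le_sup; [exists M => _ [j _ <-]|exists i]. Qed.

Lemma sup_range_le (R : realType) (I : Type) (u : I -> R) (M : R) (i : I) :
  (forall j, u j <= M) -> sup (range u) <= M.
Proof. by move=> uM; apply: ge_sup; [exists (u i), i|move=> _ [j _ <-]]. Qed.

(** Taking suprema is 1-Lipschitz. [M] and [i] make both ranges bounded and nonempty, since [sup]
    defaults to [0] otherwise. *)
Lemma sup_range_dist (R : realType) (I : Type) (u v : I -> R) (M e : R) (i : I) :
  (forall j, u j <= M) -> (forall j, v j <= M) ->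
  (forall j, `|u j - v j| <= e) -> `|sup (range u) - sup (range v)| <= e.
Proof.
move=> uM vM uve; rewrite ler_distl; apply/andP; split.
  rewrite lerBlDr; apply: (sup_range_le i) => j.
  have := uve j; rewrite ler_distl => /andP[uj _].
  have := sup_range_ge j uM; lra.
apply: (sup_range_le i) => j.
have := uve j; rewrite ler_distl => /andP[_ uj].
have := sup_range_ge j vM; lra.
Qed.

Lemma ler_dist_max0 (R : realDomainType) (a b e : R) :
  `|a - b| <= e -> `|Num.max 0 a - Num.max 0 b| <= e.
Proof.
rewrite !ler_distl => /andP[? ?].
by case: (leP 0 a) => ?; case: (leP 0 b) => ?; apply/andP; split; lra.
Qed.

(** * Locally finite weights from an equicontinuous family *)

Section equicontinuous_partition.
Context (R : realType) (I : choiceType) (X : topologicalType).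
Context (f : I -> X -> R) (f_ge0 : forall i x, 0 <= f i x).
Context (f_bounded : forall x, exists M, forall i, f i x <= M).
Context (f_equicontinuous : forall x (e : R), 0 < e ->
  \forall y \near x, forall i, `|f i y - f i x| <= e).

Let prec : rel I := sval (well_ordering_principle I).

Let prec_min (A : set I) : A !=set0 ->
  exists2 i, A i & forall j, A j -> prec i j.
Proof.
move=> [k Ak]; have wo := svalP (well_ordering_principle I).
have [|i [[iA imin] _]] := wo (mem A); first by exists k; rewrite inE.
by exists i => [|j Aj]; [rewrite inE in iA|apply: imin; rewrite inE].
Qed.

Let prec_total : total prec.
Proof.
move=> i j; have [k [->|->] kmin] := @prec_min [set i; j] (ex_intro _ i (or_introl erefl)).
  by rewrite kmin//; right.
by rewrite orbC kmin//; left.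
Qed.

(** Both indices are minima of [[set i; j]], and a well-ordering makes the minimum unique. *)
Let prec_anti i j : prec i j -> prec j i -> i = j.
Proof.
have wo := svalP (well_ordering_principle I) => ij ji.
have [|k [_ kuniq]] := wo (mem [set i; j]); first by exists i; rewrite inE; left.
have refl l : prec l l by have := prec_total l l; rewrite orbb.
rewrite -(kuniq i) ?(kuniq j)//; split; rewrite ?inE; try by [left|right];
  by move=> l; rewrite inE => -[] ->.
Qed.

(** Indices that are not strict predecessors contribute [0]; as [f] is nonnegative, this only keeps
    the range nonempty when there is no predecessor. *)
Let pred_le i x j := if (j != i) && prec j i then f j x else 0.
Let sup_pred i x := sup (range (pred_le i x)).
Let excess i x := Num.max 0 (f i x - sup_pred i x).
Let top x := sup (range (excess ^~ x)).

(* [excess i x > tau] holds for finitely many [i] only, since such indices have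
   [tau]-separated values [f i x]; by equicontinuity the threshold [top x / 2]
   then makes the family locally finite, while keeping a positive term. *)
Definition stone_weight i x := Num.max 0 (excess i x - top x / 2).

Let pred_le_bounded x M : (forall i, f i x <= M) ->
  forall i j, pred_le i x j <= M.
Proof.
move=> fM i j; rewrite /pred_le; case: ifP => // _.
exact: le_trans (f_ge0 i x) (fM i).
Qed.

Let sup_pred_ge0 i x : 0 <= sup_pred i x.
Proof.
have [M fM] := f_bounded x.
apply: le_trans (sup_range_ge i (pred_le_bounded fM i)).
by rewrite /pred_le eqxx.
Qed.

Let sup_pred_ge i j x : i != j -> prec i j -> f i x <= sup_pred j x.
Proof.
move=> ij pij; have [M fM] := f_bounded x.
apply: le_trans (sup_range_ge i (pred_le_bounded fM j)).
by rewrite /pred_le ij pij.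
Qed.

Let excess_le i x : excess i x <= f i x.
Proof. by rewrite /excess ge_max f_ge0 lerBlDr lerDl sup_pred_ge0. Qed.

Let excess_le_top i x : excess i x <= top x.
Proof.
have [M fM] := f_bounded x.
apply: (@sup_range_ge _ _ (excess ^~ x) M) => j.
exact: le_trans (excess_le j x) (fM j).
Qed.

(* The [prec]-least index with [f i x > 0] has [excess i x = f i x]. *)
Let top_gt0 x : (exists i, 0 < f i x) -> 0 < top x.
Proof.
move=> /(@prec_min [set i | 0 < f i x])[i /= fi0 imin].
apply: lt_le_trans (excess_le_top i x).
rewrite /excess lt_max; apply/orP; right; rewrite subr_gt0.
apply: le_lt_trans fi0; apply: (sup_range_le i) => j; rewrite /pred_le.
case: ifPn => // /andP[ji pji]; rewrite leNgt; apply/negP => fj0.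
by move/eqP: ji; apply; apply: prec_anti (pji) _; exact: imin.
Qed.

(** If [j] strictly precedes [i] and [excess i x > t], then [f j x + t < f i x]. Hence the integer
    part [h] of [f i x / t] is injective on this set, and it is bounded by that of [M / t]. *)
Let excess_finite x t : 0 < t -> finite_set [set i | t < excess i x].
Proof.
move=> t0; have [M fM] := f_bounded x.
pose h i := Num.truncn (f i x / t).
have fx0 i : 0 <= f i x / t by rewrite divr_ge0// ltW.
have sep i j : t < excess i x -> i != j -> prec j i -> (h j < h i)%N.
  move=> ti ij pji; rewrite truncn_lt_nat//.
  have := sup_pred_ge x _ pji; rewrite eq_sym => /(_ ij) fjs.
  have fij : f j x + t < f i x.
    by move: ti; rewrite /excess lt_max ltNge (ltW t0)/=; lra.
  have : f j x / t + 1 < f i x / t.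
    by rewrite -[X in _ + X](divff (lt0r_neq0 t0)) -mulrDl ltr_pM2r// invr_gt0.
  have /andP[_] := truncn_itv (fx0 i); rewrite -natr1 -/(h i); lra.
have hM i : (h i < (Num.truncn (M / t)).+1)%N.
  by rewrite ltnS le_truncn// ler_pM2r ?invr_gt0.
have hinj : {in [set i | t < excess i x] &, injective h}.
  move=> i j; rewrite !inE/= => ti tj hij; apply: contrapT => /eqP ij.
  have [pij|pji] := orP (prec_total i j).
    by have := sep j i tj; rewrite eq_sym ij hij ltnn => /(_ isT pij).
  by have := sep i j ti ij pji; rewrite hij ltnn.
rewrite -(eq_finite_set (inj_card_eq hinj)).
by apply: sub_finite_set (finite_II (Num.truncn (M / t)).+1) => _ [i _ <-] /=.
Qed.

Lemma stone_weight_ge0 i x : 0 <= stone_weight i x.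
Proof. by rewrite le_max lexx. Qed.

Lemma stone_weight_support i x : stone_weight i x != 0 -> 0 < f i x.
Proof.
have [M fM] := f_bounded x.
move=> w0; have : 0 < stone_weight i x by rewrite lt0r w0 stone_weight_ge0.
rewrite lt_max ltxx/= subr_gt0 => twe.
have t0 : 0 <= top x.
  by apply: le_trans (excess_le_top i x); rewrite le_max lexx.
apply: lt_le_trans (excess_le i x); lra.
Qed.

(** If all weights vanished, every excess would be at most [top x / 2], forcing
    [top x <= top x / 2]. *)
Lemma stone_weight_gt0 x : (exists i, 0 < f i x) -> exists i, 0 < stone_weight i x.
Proof.
move=> /[dup] -[i0 _] /top_gt0 tx.
apply: contrapT => /forallNP w0.
have : top x <= top x / 2.
  apply: (sup_range_le i0) => i; have /negP := w0 i.
  by rewrite lt_max ltxx/= -leNgt; lra.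
by apply/negP; rewrite -ltNge; lra.
Qed.

(** Suprema and truncation at [0] are 1-Lipschitz, so the error is at most that of [f i] plus that
    of [sup_pred i], uniformly in [i]. *)
Let excess_near x (e : R) : 0 < e ->
  \forall y \near x, forall i, `|excess i y - excess i x| <= e.
Proof.
move=> e0; have e20 : 0 < e / 2 by rewrite divr_gt0.
apply: filterS (f_equicontinuous x e20) => y fyx i.
have [M fM] := f_bounded x; have [N fN] := f_bounded y.
apply: ler_dist_max0.
have MM : M <= Num.max M N by rewrite le_max lexx.
have NM : N <= Num.max M N by rewrite le_max lexx orbT.
have := fyx i.
have : `|sup_pred i y - sup_pred i x| <= e / 2.
  apply: (@sup_range_dist _ _ _ _ (Num.max M N)) => // j.
  - exact: le_trans (pred_le_bounded fN i j) _.
  - exact: le_trans (pred_le_bounded fM i j) _.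
  - by rewrite /pred_le; case: ifP => // _; rewrite subrr normr0 ltW.
rewrite !ler_distl => /andP[? ?] /andP[? ?]; apply/andP; split; lra.
Qed.

Let top_dist x y (e : R) : 0 <= e ->
  (forall i, `|excess i y - excess i x| <= e) -> `|top y - top x| <= e.
Proof.
move=> e0 exy; have [[i _]|I0] := pselect ([set: I] !=set0); last first.
  have I_0 : [set: I] = set0.
    by apply/seteqP; split => // i _; apply: I0; exists i.
  by rewrite /top I_0 !image_set0 subrr normr0.
have [M fM] := f_bounded x; have [N fN] := f_bounded y.
apply: (@sup_range_dist _ _ _ _ (Num.max M N)) => // j.
  by apply: le_trans (excess_le j y) _; rewrite le_max fN orbT.
by apply: le_trans (excess_le j x) _; rewrite le_max fM.
Qed.

Lemma stone_weight_continuous i : continuous (stone_weight i).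
Proof.
move=> x; apply/cvgrPdist_le => e e0.
have e20 : 0 < e / 2 by rewrite divr_gt0.
apply: filterS (excess_near x e20) => y exy; rewrite distrC.
apply: ler_dist_max0; have := exy i; have := top_dist (ltW e20) exy.
rewrite !ler_distl => /andP[? ?] /andP[? ?]; apply/andP; split; lra.
Qed.

Lemma stone_weight_locally_finite x : (exists i, 0 < f i x) ->
  exists2 F : seq I, uniq F &
    \forall y \near x, forall i, i \notin F -> stone_weight i y = 0.
Proof.
move=> /top_gt0 tx.
have t4 : 0 < top x / 4 by rewrite divr_gt0.
(* Where [excess i x <= top x / 4], a nearby [y] has [excess i y <= 5/16 * top x], below
   [top y / 2 >= 15/32 * top x]. *)
have t16 : 0 < top x / 16 by rewrite divr_gt0.
have /finite_seqP[s sE] := excess_finite x t4.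
exists (undup s); first exact: undup_uniq.
apply: filterS (excess_near x t16) => y exy i.
rewrite mem_undup => /negP is_; have {is_} : ~ (top x / 4 < excess i x).
  by move=> tei; apply: is_; have : [set` s] i by rewrite -sE.
move/negP; rewrite -leNgt => eix.
have := exy i; have := top_dist (ltW t16) exy.
rewrite !ler_distl => /andP[? ?] /andP[? ?].
by apply/max_idPl; lra.
Qed.

End equicontinuous_partition.

(** * Convex sets, hulls and distances *)

Lemma convex_setP (R : realType) (M : lmodType R) (A : set M) :
  @convex_set R M A <->
  forall x y t, A x -> A y -> 0 <= t <= 1 -> A (t *: x + (1 - t) *: y).
Proof.
split=> [cA x y t Ax Ay /andP[t0 t1]|cA x y t].
  have := cA x y (Itv01 t0 t1); rewrite !inE; exact.
rewrite !inE => Ax Ay; apply: cA => //; apply/andP; split; [exact: ge0|exact: le1].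
Qed.

Lemma convex_set_sum (R : realType) (M : lmodType R) (A : set M) (I : eqType)
    (s : seq I) (w : I -> R) (v : I -> M) :
  @convex_set R M A -> (forall i, 0 <= w i) ->
  (forall i, w i != 0 -> A (v i)) -> 0 < \sum_(i <- s) w i ->
  A ((\sum_(i <- s) w i)^-1 *: \sum_(i <- s) w i *: v i).
Proof.
move=> /convex_setP cA w0 Av.
(* The induction must survive tails of zero weight: their sum is still total times a point, which
   need not be in [A]. *)
suff [a Aa ->] : exists2 a, (0 < \sum_(i <- s) w i -> A a) &
    \sum_(i <- s) w i *: v i = (\sum_(i <- s) w i) *: a.
  by move=> W0; rewrite scalerK ?gt_eqF//; exact: Aa.
elim: s => [|i s [a Aa aE]]; first by exists 0; rewrite ?big_nil ?ltxx ?scaler0.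
rewrite !big_cons {}aE.
have [wi0|wi0] := eqVneq (w i) 0.
  by exists a; rewrite wi0 ?add0r// scale0r add0r.
have wi_gt0 : 0 < w i by rewrite lt0r wi0 w0.
have : 0 <= \sum_(j <- s) w j by apply: sumr_ge0.
rewrite le_eqVlt => /predU1P[<-|W0].
  by exists (v i) => [_|]; [exact: Av|rewrite addr0 scale0r addr0].
set W := \sum_(j <- s) w j in W0 Aa *.
have wW : 0 < w i + W by rewrite addr_gt0.
exists ((w i / (w i + W)) *: v i + (1 - w i / (w i + W)) *: a) => [_|].
  apply: cA; [exact: Av|exact: Aa|].
  by rewrite divr_ge0 ?(ltW wW) ?w0//= ler_pdivrMr// mul1r lerDl ltW.
rewrite scalerDr !scalerA mulrBr mulr1 mulrC divfK ?gt_eqF//.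
by congr (_ + _ *: _); rewrite addrAC subrr add0r.
Qed.

Lemma conv_hull_convex (R : realType) (M : normedModType R) (A : set M) :
  @convex_set R M (conv_hull A).
Proof.
apply/convex_setP => x y t hx hy t01 C [cC AC].
by move/convex_setP: (cC); apply => //; [exact: hx|exact: hy].
Qed.

Lemma ball_convex (R : realType) (M : normedModType R) (z : M) (t : R) :
  @convex_set R M (ball z t).
Proof.
apply/convex_setP => x y s.
rewrite -ball_normE/= => zx zy /andP[s0 s1].
have -> : z - (s *: x + (1 - s) *: y) = s *: (z - x) + (1 - s) *: (z - y).
  by rewrite !scalerBr addrACA -scalerDl subrKC scale1r -opprD.
apply: le_lt_trans (ler_normD _ _) _; rewrite !normrZ (ger0_norm s0).
rewrite ger0_norm ?subr_ge0//.
(* Strictness comes from the [y] term if [s = 0], and from the [x] term otherwise. *)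
have [->|sn0] := eqVneq s 0; first by rewrite mul0r subr0 mul1r add0r.
have s_gt0 : 0 < s by rewrite lt0r sn0.
rewrite -[ltRHS]mul1r -[X in X * t](subrKC s) [ltRHS]mulrDl.
by rewrite ltr_leD// ?ltr_pM2l// ler_wpM2l ?subr_ge0// ltW.
Qed.

Lemma conv_hull_ball (R : realType) (M : normedModType R) (A : set M) (z : M)
    (t : R) : conv_hull (A `&` ball z t) `<=` ball z t.
Proof. by apply: smallest_sub => [|x []//]; exact: ball_convex. Qed.

Lemma edist_inf_ltP (R : realType) (M : normedModType R) (A : set M) (z : M) (t : R) :
  (edist_inf A z < t%:E)%E <-> exists2 y, A y & `|z - y| < t.
Proof.
split=> [/ereal_inf_lt[_ [y Ay <-]] /edist_lt_ball|[y Ay zy]].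
  by rewrite -ball_normE; exists y.
have d0 := normr_ge0 (z - y).
(* Lying in a ball gives only a weak bound of [edist] by its radius, hence a radius strictly between
   [|z - y|] and [t]. *)
apply: (@le_lt_trans _ _ ((`|z - y| + t) / 2)%:E); last by rewrite lte_fin; lra.
apply: (@le_trans _ _ (edist (z, y))).
  by apply: ereal_inf_lbound; exists y.
by apply: edist_fin; [lra|rewrite -ball_normE/=; lra].
Qed.

(** * Continuous approximate selections *)

Section approximate_selection.
Context (R : realType) (B : normedModType R) (P : set B).

(** Indexing by all of [B], with zero tents off [P], avoids a subtype. *)
Let tent (y : B) (p : B * R) : R :=
  if `[< P y >] then Num.max 0 (p.2 - `|p.1 - y|) else 0.

Let tent_ge0 y p : 0 <= tent y p.
Proof. by rewrite /tent; case: ifP => // _; rewrite le_max lexx. Qed.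

Let tent_bounded p : exists M, forall y, tent y p <= M.
Proof.
exists (Num.max 0 p.2) => y; rewrite /tent; case: ifP => _; last by rewrite le_max lexx.
have := normr_ge0 (p.1 - y).
by rewrite ge_max !le_max lexx/= => ?; apply/orP; right; lra.
Qed.

(** A tent changes by at most the change of centre plus the change of radius, whatever [y] is. *)
Let tent_equicontinuous p (e : R) : 0 < e ->
  \forall q \near p, forall y, `|tent y q - tent y p| <= e.
Proof.
move=> e0; have e20 : 0 < e / 2 by rewrite divr_gt0.
have near1 : \forall q \near p, `|p.1 - q.1| < e / 2.
  exact: (@cvgr_dist_lt _ _ _ _ _ fst p.1 cvg_fst _ e20).
have near2 : \forall q \near p, `|p.2 - q.2| < e / 2.
  exact: (@cvgr_dist_lt _ _ _ _ _ snd p.2 cvg_snd _ e20).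
near=> q => y; rewrite /tent; case: ifP => _; last by rewrite subrr normr0 ltW.
apply: ler_dist_max0.
have q1 : `|p.1 - q.1| < e / 2 by near: q.
have q2 : `|p.2 - q.2| < e / 2 by near: q.
have := ler_dist_dist (p.1 - y) (q.1 - y); rewrite opprB addrA subrK => q3.
move: q2 (le_lt_trans q3 q1).
rewrite ltr_distl => /andP[? ?]; rewrite ltr_distl => /andP[? ?].
rewrite ler_distl; apply/andP; split; lra.
Unshelve. all: by end_near. Qed.

Let tent_gt0P y z t : 0 < tent y (z, t) <-> P y /\ `|z - y| < t.
Proof.
rewrite /tent; case: asboolP => Py/=; last by rewrite ltxx; split=> // -[].
by rewrite lt_max ltxx/= subr_gt0; split=> // -[].
Qed.

Let weight := stone_weight tent.

Lemma approximate_selection : exists Phi : B * R -> B, forall z t,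
  (exists2 y, P y & `|z - y| < t) ->
  {for (z, t), continuous Phi} /\ conv_hull (P `&` ball z t) (Phi (z, t)).
Proof.
(* Sums over finite supports define [Phi] globally; near a point of the domain they reduce to sums
   over one fixed list [F]. *)
pose Phi p := (\sum_(y \in [set: B]) weight y p)^-1 *:
  \sum_(y \in [set: B]) weight y p *: y.
exists Phi => z t [y0 Py0 zy0].
have ex0 : exists y, 0 < tent y (z, t) by exists y0; apply/tent_gt0P.
have [F uF F0] := stone_weight_locally_finite tent_ge0 tent_bounded
  tent_equicontinuous ex0.
pose S p := \sum_(y <- F) weight y p.
pose V p := \sum_(y <- F) weight y p *: y.
have PhiE p : (forall y, y \notin F -> weight y p = 0) -> Phi p = (S p)^-1 *: V p.
  move=> pF0; rewrite /Phi; congr (_^-1 *: _).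
    rewrite (fsbigE F)//; last by move=> y _; exact: pF0.
    by apply: eq_bigl => y; rewrite in_setT.
  rewrite (fsbigE F)//; last by move=> y _ /pF0 ->; rewrite scale0r.
  by apply: eq_bigl => y; rewrite in_setT.
have w_ge0 y p : 0 <= weight y p by exact: stone_weight_ge0.
have S0 : 0 < S (z, t).
  have [y wy] := stone_weight_gt0 tent_ge0 tent_bounded ex0.
  have yF : y \in F.
    by apply: contraLR wy => /(nbhs_singleton F0) ->; rewrite ltxx.
  rewrite /S (big_rem y)//=; apply: ltr_wpDr => //.
  by apply: sumr_ge0 => i _.
have wc y : continuous (weight y) := stone_weight_continuous tent_ge0
  tent_bounded tent_equicontinuous (i := y).
split.
  apply: (@cvg_trans _ (((S p)^-1 *: V p) @[p --> (z, t)])).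
    apply: near_eq_cvg; apply: filterS F0 => p pF0; by rewrite PhiE.
  rewrite PhiE; last exact: nbhs_singleton F0.
  have SV : S p @[p --> (z, t)] --> S (z, t).
    apply: cvg_big => [|y _]; [exact: add_continuous|exact: wc].
  have VV : V p @[p --> (z, t)] --> V (z, t).
    apply: cvg_big => [|y _]; [exact: add_continuous|exact: cvgZr_tmp (wc y _)].
  exact: cvgZ (cvgV (lt0r_neq0 S0) SV) VV.
rewrite PhiE; last exact: nbhs_singleton F0.
apply: convex_set_sum => //; first exact: conv_hull_convex.
move=> y /(stone_weight_support tent_ge0 tent_bounded)/tent_gt0P[Py zy].
by apply: sub_gen_smallest; split => //; rewrite -ball_normE.
Qed.

End approximate_selection.

(** * Continuous selections by iteration *)

Lemma closed_approx (R : realType) (V : normedModType R) (A : set V) (z : V) :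
  closed A -> (forall e : R, 0 < e -> exists2 y, A y & `|z - y| < e) -> A z.
Proof.
move=> cA zA; apply: cA => U /nbhs_ballP[e e0 eU].
have [y Ay zy] := zA e e0.
by exists y; split => //; apply: eU; rewrite -ball_normE.
Qed.

Section paraconvex_selection.
Context (R : realType) (B : completeNormedModType R) (P : set B).
Context (alpha beta : R) (alpha_ge0 : 0 <= alpha).
Context (alpha_beta : alpha < beta) (beta_lt1 : beta < 1).
Context (paraconvex_P : paraconvex alpha P).

Let beta_gt0 : 0 < beta. Proof. exact: le_lt_trans alpha_beta. Qed.

Let omb_gt0 : 0 < 1 - beta. Proof. by rewrite subr_gt0. Qed.

Let reach (p : B * R) := exists2 y, P y & `|p.1 - y| < p.2.

Let reach_gt0 p : reach p -> 0 < p.2.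
Proof. by move=> [y _]; exact: le_lt_trans. Qed.

Let near_reach p : reach p -> \forall q \near p, reach q.
Proof.
move=> [y Py py].
have d0 : 0 < (p.2 - `|p.1 - y|) / 2 by lra.
have near1 : \forall q \near p, `|p.1 - q.1| < (p.2 - `|p.1 - y|) / 2.
  exact: (@cvgr_dist_lt _ _ _ _ _ fst p.1 cvg_fst _ d0).
have near2 : \forall q \near p, `|p.2 - q.2| < (p.2 - `|p.1 - y|) / 2.
  exact: (@cvgr_dist_lt _ _ _ _ _ snd p.2 cvg_snd _ d0).
near=> q; exists y => //.
have q1 : `|p.1 - q.1| < (p.2 - `|p.1 - y|) / 2 by near: q.
have : `|p.2 - q.2| < (p.2 - `|p.1 - y|) / 2 by near: q.
have := ler_distD p.1 q.1 y; rewrite (distrC q.1 p.1).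
rewrite ltr_distl => ? /andP[? ?]; lra.
Unshelve. all: by end_near. Qed.

(** The gap between [alpha] and [beta] turns a weak bound on the distance into a point of [P] at
    distance strictly below [beta * r]. *)
Let conv_reach c r q : 0 < r -> conv_hull (P `&` ball c r) q -> reach (q, beta * r).
Proof.
move=> r0 qP; have [_ _ /(_ r c q r0 qP) qr] := paraconvex_P.
apply/edist_inf_ltP; apply: le_lt_trans qr _.
by rewrite lte_fin ltr_pM2r.
Qed.

Lemma paraconvex_selection : exists Psi : B * R -> B, forall z t,
  (exists2 y, P y & `|z - y| < t) ->
  [/\ {for (z, t), continuous Psi}, P (Psi (z, t)) &
      `|Psi (z, t) - z| <= t / (1 - beta)].
Proof.
have [Phi PhiP] := approximate_selection P.
pose fix a (n : nat) (p : B * R) {struct n} : B := if n is m.+1 then Phi (a m p, beta ^+ m * p.2) else p.1.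
have aS n p : a n.+1 p = Phi (a n p, beta ^+ n * p.2) by [].
have bt_gt0 n p : reach p -> 0 < beta ^+ n * p.2.
  by move=> /reach_gt0 p0; rewrite mulr_gt0 ?exprn_gt0.
(* Each application of [Phi] multiplies the radius by [beta], so the next pair is again in the
   domain of [Phi]. *)
have a_reach n p : reach p -> reach (a n p, beta ^+ n * p.2).
  move=> pP; elim: n => [|n IHn]; first by rewrite expr0 mul1r.
  rewrite exprS -mulrA aS; apply: (conv_reach (bt_gt0 n p pP)).
  by have [_] := PhiP _ _ IHn; apply.
have a_step n p : reach p -> `|a n.+1 p - a n p| <= beta ^+ n * p.2.
  move=> /(a_reach n)/PhiP[_ /conv_hull_ball]; rewrite -ball_normE/= => aP.
  by rewrite distrC ltW.
have a_dist n p : reach p -> forall m, (n <= m)%N ->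
    `|a m p - a n p| <= beta ^+ n * (p.2 / (1 - beta)).
  move=> pP m nm; rewrite -(subnKC nm).
  (* The exact partial geometric sum is kept so that the induction telescopes. *)
  apply: (@le_trans _ _ ((beta ^+ n - beta ^+ (n + (m - n))) * (p.2 / (1 - beta)))).
    elim: (m - n)%N => [|k IHk]; first by rewrite addn0 !subrr normr0 mul0r.
    rewrite addnS; apply: le_trans (ler_distD (a (n + k)%N p) _ _) _.
    have := lerD (a_step (n + k)%N p pP) IHk; move/le_trans; apply.
    rewrite le_eqVlt; apply/orP; left; apply/eqP; rewrite exprS.
    by field; rewrite gt_eqF.
  rewrite ler_pM2r ?divr_gt0 ?reach_gt0// lerBlDr lerDl exprn_ge0// ltW//.
have small (c e : R) : 0 < e -> exists n, beta ^+ n * c < e.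
  move=> e0; have : geometric c beta n @[n --> \oo] --> 0.
    by apply: cvg_geometric; rewrite gtr0_norm.
  move=> /cvgrPdist_lt/(_ e e0)[N _ /(_ N (leqnn N))]/=.
  rewrite sub0r normrN mulrC => cN; exists N.
  exact: le_lt_trans (ler_norm _) cN.
pose Psi p : B := lim (a n p @[n --> \oo]).
have a_cvg p : reach p -> a n p @[n --> \oo] --> Psi p.
  move=> pP; apply: cauchy_cvg; apply: cauchy_exP => e e0.
  have [n ne] := small (p.2 / (1 - beta)) e e0.
  exists (a n p), n => // m nm /=; rewrite -ball_normE/= distrC.
  exact: le_lt_trans (a_dist n p pP m nm) ne.
have Psi_dist n p : reach p ->
    `|Psi p - a n p| <= beta ^+ n * (p.2 / (1 - beta)).
  move=> pP; apply/ler_addgt0Pr => e e0.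
  have /cvgrPdist_lt/(_ e e0)[N _ Ne] := a_cvg p pP.
  have := Ne (maxn N n) (leq_maxl _ _) => /= Nm.
  apply: le_trans (ler_distD (a (maxn N n) p) _ _) _.
  by rewrite addrC lerD ?(ltW Nm)// a_dist// leq_maxr.
have a_cont n p : reach p -> {for p, continuous (a n)}.
  move=> pP; elim: n => [|n IHn]; first exact: cvg_fst.
  have [Phic _] := PhiP _ _ (a_reach n p pP).
  apply: (@cvg_comp _ _ _ (fun q => (a n q, beta ^+ n * q.2)) Phi); last exact: Phic.
  have bq : beta ^+ n * q.2 @[q --> p] --> beta ^+ n * p.2.
    by apply: (@cvgM R _ _ _ (cst (beta ^+ n)) snd); [exact: cvg_cst|exact: cvg_snd].
  exact: (cvg_pair IHn bq).
exists Psi => z t pP; rewrite -/(reach (z, t)) in pP; split.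
- apply/cvgrPdist_lt => e e0; have e30 : 0 < e / 3 by rewrite divr_gt0.
  (* Points near [(z, t)] have radius at most [t + 1], so one [n] bounds the error of [a n] at all
     of them. *)
  have [n ne] := small ((t + 1) / (1 - beta)) (e / 3) e30.
  have near2 : \forall q \near (z, t), `|t - q.2| < 1.
    exact: (@cvgr_dist_lt _ _ _ _ _ snd t cvg_snd _ ltr01).
  have /cvgrPdist_lt/(_ _ e30) nearn := a_cont n _ pP.
  have bound q : reach q -> q.2 <= t + 1 -> `|Psi q - a n q| < e / 3.
    move=> /(Psi_dist n) + qt; move=> /le_lt_trans; apply; apply: le_lt_trans ne.
    by rewrite ler_pM2l ?exprn_gt0// ler_pM2r ?invr_gt0.
  near=> q.
  have qP : reach q by near: q; exact: near_reach.
  have qn : `|a n (z, t) - a n q| < e / 3 by near: q.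
  have : `|t - q.2| < 1 by near: q.
  rewrite ltr_distl => /andP[qt _].
  have b1 : `|Psi (z, t) - a n (z, t)| < e / 3.
    by apply: bound => //=; rewrite lerDl.
  have b2 : `|Psi q - a n q| < e / 3 by apply: bound => //; lra.
  apply: le_lt_trans (ler_distD (a n q) _ _) _.
  have := ler_distD (a n (z, t)) (Psi (z, t)) (a n q).
  rewrite (distrC (a n q)); lra.
- have [_ cP _] := paraconvex_P; apply: closed_approx (cP) _ => e e0.
  have e20 : 0 < e / 2 by rewrite divr_gt0.
  (* [n] controls the distance from the limit to the iterate, [m] that from the iterate to [P];
     their maximum serves both. *)
  have [n ne] := small (t / (1 - beta)) (e / 2) e20.
  have [m me] := small t (e / 2) e20.
  have [y Py ya] := a_reach (maxn n m) _ pP.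
  exists y => //; apply: le_lt_trans (ler_distD (a (maxn n m) (z, t)) _ _) _.
  have t0 := reach_gt0 pP; rewrite /= in t0 ya.
  have := Psi_dist (maxn n m) _ pP => /=.
  have mono k : (k <= maxn n m)%N -> beta ^+ maxn n m <= beta ^+ k.
    by move=> km; apply: ler_wiXn2l => //; exact: ltW.
  have : beta ^+ maxn n m * (t / (1 - beta)) <= beta ^+ n * (t / (1 - beta)).
    by rewrite ler_pM2r ?divr_gt0// mono// leq_maxl.
  have : beta ^+ maxn n m * t <= beta ^+ m * t.
    by rewrite ler_pM2r// mono// leq_maxr.
  lra.
- by have := Psi_dist 0 _ pP; rewrite expr0 mul1r.
Unshelve. all: by end_near. Qed.

End paraconvex_selection.

(** * The real-valued distance to a nonempty set *)

Section distance.
Context (R : realType) (B : normedModType R) (P : set B) (P0 : P !=set0).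

Definition set_dist (z : B) : R := fine (edist_inf P z).

Lemma edist_infE z : edist_inf P z = (set_dist z)%:E.
Proof.
rewrite fineK// ge0_fin_numE ?edist_inf_ge0//; have [y Py] := P0.
apply: (@lt_trans _ _ (`|z - y| + 1)%:E); last exact: ltry.
by apply/edist_inf_ltP; exists y => //; rewrite ltrDl.
Qed.

Lemma set_dist_ltP z t : set_dist z < t <-> exists2 y, P y & `|z - y| < t.
Proof. by rewrite -edist_inf_ltP edist_infE lte_fin. Qed.

Lemma set_dist_ge0 z : 0 <= set_dist z.
Proof. by rewrite fine_ge0 ?edist_inf_ge0. Qed.

Lemma set_dist_continuous : continuous set_dist.
Proof.
move=> z; apply: fine_cvg; rewrite -edist_infE; exact: edist_inf_continuous.
Qed.

Lemma set_dist_gt0 z : closed P -> ~ P z -> 0 < set_dist z.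
Proof.
move=> cP Pz; rewrite lt0r set_dist_ge0 andbT; apply/eqP => dz0; apply: Pz.
by apply: closed_approx => // e e0; apply/set_dist_ltP; rewrite dz0.
Qed.

Lemma set_dist_triangle x z : set_dist x <= `|x - z| + set_dist z.
Proof.
apply/ler_addgt0Pr => e e0; apply/ltW/set_dist_ltP.
have /set_dist_ltP[y Py zy] : set_dist z < set_dist z + e by rewrite ltrDl.
exists y => //; apply: le_lt_trans (ler_distD z x y) _.
by rewrite -addrA ltrD2l.
Qed.

End distance.

(** * Uniform retractions near a given map *)

Section retraction_near.
Context (R : realType) (B : completeNormedModType R) (P : set B).
Context (alpha beta : R) (alpha_ge0 : 0 <= alpha).
Context (alpha_beta : alpha < beta) (beta_lt1 : beta < 1).
Context (paraconvex_P : paraconvex alpha P).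

Lemma retraction_near (g : B -> B) (eps : R) : 0 < eps ->
  continuous g -> (forall a, P a -> g a = a) -> uniform_retraction P g ->
  exists f, [/\ continuous_retraction P f, uniform_retraction P f &
    forall x, `|f x - g x| <= (set_dist P (g x) + eps) / (1 - beta)].
Proof.
move=> eps0 gc gP gu; have [P0 cP _] := paraconvex_P.
have c0 : 0 < 1 - beta by rewrite subr_gt0.
have [Psi PsiP] := paraconvex_selection alpha_ge0 alpha_beta beta_lt1 paraconvex_P.
(* The second summand makes [set_dist P (g x) < rho x] strict off [P]; its cap [eps] yields the
   final estimate. *)
pose rho x := set_dist P (g x) + Num.min eps (set_dist P x).
pose f x := if `[< P x >] then x else Psi (g x, rho x).
have fP x : P x -> f x = x by move=> Px; rewrite /f asboolT.
have fNP x : ~ P x -> f x = Psi (g x, rho x) by move=> Px; rewrite /f asboolF.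
have rho_reach x : ~ P x -> exists2 y, P y & `|g x - y| < rho x.
  move=> Px; apply/(set_dist_ltP P0).
  by rewrite /rho ltrDl lt_min eps0 set_dist_gt0.
have rho_ge0 x : 0 <= rho x.
  by rewrite addr_ge0 ?set_dist_ge0// le_min set_dist_ge0 ltW.
have fg x : `|f x - g x| <= rho x / (1 - beta).
  have [Px|Px] := pselect (P x).
    by rewrite fP// gP// subrr normr0 divr_ge0// ltW.
  by rewrite fNP//; have [] := PsiP _ _ (rho_reach x Px).
have fu : uniform_retraction P f.
  (* With this quarter, [rho x] is at most [|g x - x|] plus twice the distance from [x] to [P], so
     [f] is within [3 * e / 4] of [g]; the last quarter covers [|x - g x|]. *)
  move=> e e0; have e40 : 0 < e * (1 - beta) / 4 by rewrite divr_gt0// mulr_gt0.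
  have [d d0 gd] := gu _ e40.
  exists (Num.min d (e * (1 - beta) / 4)) => [|x]; first by rewrite lt_min d0.
  rewrite edist_infE// lte_fin lt_min => /andP[xd xe].
  have xgx : `|x - g x| < e * (1 - beta) / 4.
    by apply: gd; rewrite edist_infE// lte_fin.
  apply: le_lt_trans (ler_distD (g x) _ _) _; rewrite (distrC (g x)).
  have : rho x <= 3 * (e * (1 - beta) / 4).
    have := set_dist_triangle P0 (g x) x; rewrite (distrC (g x)).
    have : Num.min eps (set_dist P x) <= set_dist P x by rewrite ge_min lexx orbT.
    rewrite /rho; lra.
  rewrite -(ler_pM2r (x := (1 - beta)^-1)) ?invr_gt0//.
  have -> : 3 * (e * (1 - beta) / 4) / (1 - beta) = 3 * e / 4.
    by field; rewrite gt_eqF.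
  have : e * (1 - beta) <= e.
    by rewrite ger_pMr// gerBl (le_trans alpha_ge0 (ltW alpha_beta)).
  have := fg x; lra.
exists f; split => //; last first.
  move=> x; apply: le_trans (fg x) _; rewrite ler_pM2r ?invr_gt0// lerD2l.
  by rewrite ge_min lexx.
split => //; last first.
  move=> _ [x _ <-]; have [Px|Px] := pselect (P x); first by rewrite fP.
  by rewrite fNP//; have [] := PsiP _ _ (rho_reach x Px).
move=> x; have [Px|Px] := pselect (P x).
  (* At points of [P], continuity follows from uniformity: [f] barely moves points close to [P]. *)
  apply/cvgrPdist_lt => e e0; have e20 : 0 < e / 2 by rewrite divr_gt0.
  have [d d0 fd] := fu _ e20; rewrite fP//.
  have near1 : \forall y \near x, `|x - y| < d.
    exact: (@cvgr_dist_lt _ _ _ _ _ id x cvg_id _ d0).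
  have near2 : \forall y \near x, `|x - y| < e / 2.
    exact: (@cvgr_dist_lt _ _ _ _ _ id x cvg_id _ e20).
  near=> y; apply: le_lt_trans (ler_distD y _ _) _; rewrite (splitr e).
  apply: ltrD; first by near: y.
  by apply: fd; apply/edist_inf_ltP; exists x => //; rewrite distrC; near: y.
have [Psic _ _] := PsiP _ _ (rho_reach x Px).
rewrite /continuous_at fNP//.
apply: (@cvg_trans _ (Psi (g y, rho y) @[y --> x])).
  apply: near_eq_cvg; have : nbhs x (~` P).
    by apply: open_nbhs_nbhs; split => //; exact: closed_openC.
  by apply: filterS => y Py; rewrite fNP.
apply: (@cvg_comp _ _ _ (fun y => (g y, rho y)) Psi); last exact: Psic.
have dgc : set_dist P (g y) @[y --> x] --> set_dist P (g x).
  apply: (@cvg_comp _ _ _ g (set_dist P) _ (nbhs (g x))); first exact: gc.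
  exact: set_dist_continuous.
have minc : Num.min eps (set_dist P y) @[y --> x] --> Num.min eps (set_dist P x).
  apply: (@continuous_min R B (cst eps) (set_dist P) x); first exact: cvg_cst.
  exact: set_dist_continuous.
have rc : rho y @[y --> x] --> rho x by exact: cvgD dgc minc.
exact: (cvg_pair (gc x) rc).
Unshelve. all: by end_near. Qed.

End retraction_near.

(** * The set of uniform retractions inside [Cb B B] *)

Lemma Cb_ball (R : realType) (X : topologicalType) (Y : normedModType R)
    (c f : Cb X Y) (r : R) (x : X) : ball c r f -> ball (c x) r (f x).
Proof.
by rewrite -!ball_normE/=; apply: le_lt_trans; exact: (sup_norm_ub (c - f) x).
Qed.

Lemma continuous_retraction_Cb (R : realType) (B : normedModType R) (P : set B)
    (f : B -> B) : bounded_set P -> continuous_retraction P f -> f \in @Cb_pred R B B.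
Proof.
move=> bP [fc fP _]; apply/asboolP; split=> //; apply/bounded_funE.
have [M PM] := @filter_ex _ (+oo : set_system R) _ _ bP.
by exists M => x; apply: PM; apply: fP; exists x.
Qed.

(** Convex combinations may leave [P], but these three properties hold for the generators and are
    stable under convex combination, so the hull inherits them. *)
Lemma conv_hull_URetr (R : realType) (B : normedModType R) (P : set B)
    (r : R) (c q : Cb B B) : conv_hull (URetr P `&` ball c r) q ->
  [/\ uniform_retraction P q, forall a, P a -> q a = a &
      forall x, conv_hull (P `&` ball (c x) r) (q x)].
Proof.
pose C : set (Cb B B) := [set q | [/\ uniform_retraction P q,
  forall a, P a -> q a = a & forall x, conv_hull (P `&` ball (c x) r) (q x)]].
suff : conv_hull (URetr P `&` ball c r) `<=` C by apply.
apply: smallest_sub => [|f [[[_ fP fid] fu] cf]]; last first.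
  split=> // x; apply: sub_gen_smallest; split; last exact: Cb_ball.
  by apply: fP; exists x.
apply/convex_setP => f g t [fu fid fr] [gu gid gr] t01; split.
- move=> e e0; have [d d0 fd] := fu e e0; have [k k0 gk] := gu e e0.
  exists (Num.min d k); first by rewrite lt_min d0.
  move=> x /edist_inf_ltP[y Py]; rewrite lt_min => /andP[xyd xyk].
  (* Uniformity says that values lie in the convex ball about [x]. *)
  have [cb _] := @convex_setP R B (ball x e).
  have xf : ball x e (f x).
    by rewrite -ball_normE; apply: fd; apply/edist_inf_ltP; exists y.
  have xg : ball x e (g x).
    by rewrite -ball_normE; apply: gk; apply/edist_inf_ltP; exists y.
  have := cb (@ball_convex _ _ x e) _ _ t xf xg t01.
  by rewrite -ball_normE.
- move=> a Pa; have -> : (t *: f + (1 - t) *: g) a = t *: f a + (1 - t) *: g a by [].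
  by rewrite fid// gid// -scalerDl subrKC scale1r.
- move=> x; have [cb _] := @convex_setP R B (conv_hull (P `&` ball (c x) r)).
  exact: (cb (@conv_hull_convex _ _ _) (f x) (g x) t).
Qed.

(** Each defining condition survives sup-norm limits; the range condition uses that [P] is
    closed. *)
Lemma URetr_closed (R : realType) (B : normedModType R) (P : set B) :
  closed P -> closed (URetr P).
Proof.
move=> cP f clf.
have approx (e : R) : 0 < e ->
    exists2 g : Cb B B, URetr P g & forall x, `|f x - g x| < e.
  move=> e0; have [g [Pg fg]] := clf _ (nbhsx_ballx f e e0).
  by exists g => // x; have := Cb_ball x fg; rewrite -ball_normE.
split; [split|].
- exact: Cb_continuous.
- move=> _ [x _ <-]; apply: closed_approx => // e e0.
  have [g [[_ gP _] _] fg] := approx e e0.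
  by exists (g x) => //; apply: gP; exists x.
- move=> a Pa; apply/eqP; rewrite -subr_eq0 -normr_le0; apply/ler_addgt0Pr => e e0.
  have [g [[_ _ gid] _] fg] := approx e e0.
  by rewrite add0r ltW// -{2}(gid a Pa).
- move=> e e0; have e20 : 0 < e / 2 by rewrite divr_gt0.
  have [g [_ gu] fg] := approx (e / 2) e20; have [d d0 gd] := gu _ e20.
  exists d => // x xd; apply: le_lt_trans (ler_distD (g x) _ _) _.
  by rewrite (splitr e) ltrD ?gd// distrC.
Qed.

(** * Paraconvexity of the set of uniform retractions *)

Theorem proposition2p2 (R : realType) (B : completeNormedModType R)
    (alpha : R) (alpha_ge0 : 0 <= alpha) (alpha_lt1 : alpha < 1)
    (P : set B)
    (bounded_P : bounded_set P) (paraconvex_P : paraconvex alpha P) :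
  paraconvex (alpha / (1 - alpha)) (URetr P).
Proof.
have [P0 cP pP] := paraconvex_P.
split; first 2 last.
- move=> r c q r0 qU; have [qu qid qr] := conv_hull_URetr qU.
  apply/lee_addgt0Pr => e e0; apply/ltW; rewrite -EFinD.
  have K0 : 0 < 1 - alpha by rewrite subr_gt0.
  have A0 : 0 <= alpha * r by rewrite mulr_ge0// ltW.
  have eK0 : 0 < e * (1 - alpha) by rewrite mulr_gt0.
  set K := 1 - alpha in K0 eK0 *; set A := alpha * r in A0.
  have D0 : 0 < 2 * (K + A + e * K) by lra.
  (* With [beta = alpha + t] and [eps = t] the retraction is within [(A + t) / (K - t)] of [q]. This
     is below [A / K + e] when [t * (K + A + e * K) < e * K * K]; [t] is half that threshold. *)
  pose t := e * K * K / (2 * (K + A + e * K)).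
  have t0 : 0 < t by rewrite divr_gt0// mulr_gt0.
  have tE : t * (2 * (K + A + e * K)) = e * K * K by rewrite /t divfK ?gt_eqF.
  have tK : t < K.
    rewrite /t ltr_pdivrMr//; have : 0 < K * (2 * (K + A) + e * K).
      by rewrite mulr_gt0//; lra.
    lra.
  have t1 : alpha + t < 1 by rewrite -ltrBrDl.
  have at_ : alpha < alpha + t by rewrite ltrDl.
  have [f [fr fu fq]] := retraction_near alpha_ge0 at_ t1 paraconvex_P t0
    (@Cb_continuous _ _ _ q) qid qu.
  apply/edist_inf_ltP; exists (MkCb (continuous_retraction_Cb bounded_P fr)) => //.
  have Kt0 : 0 < K - t by rewrite subr_gt0.
  apply: (@le_lt_trans _ _ ((A + t) / (K - t))); last first.
    have -> : alpha / K * r + e = (A + e * K) / K.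
      by rewrite /A; field; rewrite gt_eqF.
    rewrite ltr_pdivrMr// mulrAC ltr_pdivlMr//.
    have : 0 < e * K * K by rewrite mulr_gt0.
    lra.
  rewrite distrC; apply: sup_norm_le => [|x].
    by rewrite divr_ge0 ?(ltW Kt0)// addr_ge0// ltW.
  (* Paraconvexity of [P] for the ball about [c x] bounds the distance from [q x] to [P] by [A],
     uniformly in [x]. *)
  apply: le_trans (fq x) _; rewrite opprD addrA ler_pM2r ?invr_gt0// lerD2r.
  by have := pP r (c x) (q x) r0 (qr x); rewrite edist_infE.
(* For nonemptiness any [beta] strictly between [alpha] and [1] will do, with the identity as the
   map to approximate. *)
- have ab : alpha < (alpha + 1) / 2 by lra.
  have b1 : (alpha + 1) / 2 < 1 by lra.
  have idu : uniform_retraction P id.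
    by move=> e e0; exists 1 => // x _; rewrite subrr normr0.
  have [f [fr fu _]] := retraction_near alpha_ge0 ab b1 paraconvex_P ltr01
    (fun x => cvg_id) (fun a _ => erefl) idu.
  by exists (MkCb (continuous_retraction_Cb bounded_P fr)).
- exact: URetr_closed.
Qed.
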